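(* For every integer $t\geq 2$, $$125 \cdot 7^{t-2} +1 \leq R_t(4).$$
   Context: A tournament of order $m$ is an orientation of the complete graph on $m$ vertices; it is transitive if its vertices can be listed $a_1,\dots,a_m$ with $a_i \to a_j$ for all $i<j$. The multicolor directed Ramsey number $R(n_1,n_2,\dots,n_t)$ is the smallest integer $m$ such that any tournament of order $m$ whose edges have been colored with $t$ colors contains, for some $1 \leq i \leq t$, a transitive subtournament of order $n_i$ all of whose edges have color $i$ (these numbers exist). $R_t(n)$ denotes $R(n,n,\dots,n)$ with $t$ arguments. *)

(* Defs.v *)
From mathcomp Require Import all_boot.

Set Implicit Arguments.
Unset Strict Implicit.
Unset Printing Implicit Defensive.

Section Tournament.
Variable V : finType.
Implicit Types (e : rel V) (A : {set V}).

(* An orientation of the complete graph on V: [e x y] means x -> y. *)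
Definition tournament e : bool :=
  [forall x, ~~ e x x] && [forall x, forall y, (x != y) ==> (e x y (+) e y x)].

(* The listing [s] has no repetition, since its size is #|A| and A is its set of values. *)
Definition transitive_sub e A : bool :=
  [exists s : #|A|.-tuple V, ([set x in s] == A) && pairwise e s].

(* Each edge is represented by its unique arc x -> y, so only the values of
   the colouring [c] at pairs with [e x y] matter. *)
Definition monochromatic_sub (t : nat) e (c : V -> V -> 'I_t) (i : 'I_t) A
    : bool :=
  [forall x in A, forall y in A, e x y ==> (c x y == i)].

End Tournament.

Definition ramsey_arrow (t : nat) (n : 'I_t -> nat) (m : nat) : bool :=
  [forall e : {ffun 'I_m * 'I_m -> bool}, forall c : {ffun 'I_m * 'I_m -> 'I_t},
     tournament (fun x y => e (x, y)) ==>
     [exists i : 'I_t, exists A : {set 'I_m},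
        [&& #|A| == n i, transitive_sub (fun x y => e (x, y)) A
          & monochromatic_sub (fun x y => e (x, y)) (fun x y => c (x, y)) i A]]].

Section Existence.
Variable t : nat.

Fixpoint ramsey_bound (s : nat) : nat :=
  if s is s'.+1 then (2 * t * ramsey_bound s').+2 else 1.

Lemma ramsey_bound_list (V : finType) (e : rel V) (c : V -> V -> 'I_t) s
    (n : 'I_t -> nat) (A : {set V}) :
  tournament e -> \sum_i n i <= s -> ramsey_bound s <= #|A| ->
  exists i (l : seq V), [/\ size l = n i, {subset l <= A}
    & pairwise (fun x y => e x y && (c x y == i)) l].
Proof.
move=> /andP[_ /forallP e_tot].
elim: s n A => [|s IHs] n A sum_n leA.
  have /card_gt0P[v _] : 0 < #|A| by [].
  have /eqP n0 : n (c v v) == 0.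
    rewrite -leqn0; apply: leq_trans sum_n.
    by rewrite (bigD1 (c v v)) //= leq_addr.
  by exists (c v v), [::].
have [i /eqP ni0 | n_gt0] := pickP (fun i => n i == 0).
  by exists i, [::].
have /card_gt0P[v vA] : 0 < #|A| by apply: leq_trans leA.
pose cls x := (e v x, if e v x then c v x else c x v).
have [p leB] : exists p,
    ramsey_bound s <= #|[set x in A :\ v | cls x == p]|.
  apply/existsP; apply: contraLR leA => /existsPn small.
  rewrite -ltnNge (cardsD1 v) vA /= ltnS add1n ltnS.
  rewrite -sum1_card (partition_big cls predT) //=.
  apply: leq_trans (_ : \sum_(p : bool * 'I_t) ramsey_bound s <= _).
    apply: leq_sum => p _; rewrite sum1dep_card.
    by apply: ltnW; rewrite ltnNge; apply: small.
  by rewrite sum_nat_const card_prod card_bool card_ord.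
pose n' j := if j == p.2 then (n j).-1 else n j.
have sum_n' : \sum_j n' j <= s.
  rewrite -ltnS; apply: leq_trans sum_n.
  rewrite (bigD1 p.2) //= [X in _ < X](bigD1 p.2) //= /n' eqxx.
  rewrite -addSn prednK ?lt0n ?n_gt0 // leq_add2l.
  by apply: leq_sum => j /negbTE ->.
have [j [l [sz_l lB pl]]] := IHs n' _ sum_n' leB.
have lA : {subset l <= A} by move=> x /lB; rewrite !inE -andbA => /and3P[].
have [jp | jp] := eqVneq j p.2; last first.
  by exists j, l; split=> //; rewrite sz_l /n' (negbTE jp).
have sz : (size l).+1 = n j by rewrite sz_l /n' jp eqxx prednK // lt0n n_gt0.
have vl x : x \in l -> x != v /\ cls x = p.
  by move=> /lB; rewrite !inE -andbA => /and3P[? _ /eqP].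
exists j; case p1: p.1.
- exists (v :: l); split=> //; first by move=> x /predU1P[-> | /lA].
  rewrite /= pl andbT; apply/allP=> x /vl[_ px].
  by move: p1; rewrite jp -px /= => ->; rewrite /= eqxx.
exists (rcons l v); split; first by rewrite size_rcons.
  by move=> x; rewrite mem_rcons => /predU1P[-> | /lA].
rewrite pairwise_rcons pl andbT; apply/allP=> x /vl[xv px].
move: p1; rewrite jp -px /= => evx; rewrite evx eqxx andbT.
by move/forallP/(_ v)/implyP/(_ xv): (e_tot x); rewrite evx addbF.
Qed.

Lemma ramsey_arrow_ex (n : 'I_t -> nat) : exists m, ramsey_arrow n m.
Proof.
exists (ramsey_bound (\sum_i n i)); set m := ramsey_bound _.
apply/forallP=> e; apply/forallP=> c; apply/implyP=> te.
have [|i [l [sz _ pl]]] := ramsey_bound_list (fun x y => c (x, y)) (n := n)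
  (A := [set: 'I_m]) te (leqnn _); first by rewrite cardsT card_ord.
have /andP[/forallP e_irr /forallP e_tot] := te.
have pe : pairwise (fun x y => e (x, y)) l.
  by apply: sub_pairwise pl => x y /andP[].
have ul : uniq l.
  apply: pairwise_uniq pe => x; exact: negbTE.
have cA : #|[set x in l]| = size l by rewrite cardsE; apply/card_uniqP.
apply/existsP; exists i; apply/existsP; exists [set x in l].
apply/and3P; split; first by rewrite cA sz.
- have sl : size l == #|[set x in l]| by rewrite cA.
  by apply/existsP; exists (Tuple sl); rewrite /= pe andbT.
apply/forall_inP=> x; rewrite inE => xl; apply/forall_inP=> y; rewrite inE => yl.
apply/implyP=> exy.
have xy : x != y by apply: contraTneq exy => ->.
have eyx : e (y, x) = false.
  by move/forallP/(_ y)/implyP/(_ xy): (e_tot x); rewrite exy; case: (e (y, x)).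
have ixl := xl; have iyl := yl; rewrite -!index_mem in ixl iyl.
move/(pairwiseP x): pl => pl.
have [lt_xy | lt_yx | eq_xy] := ltngtP (index x l) (index y l).
- by have := pl _ _ ixl iyl lt_xy; rewrite !nth_index // => /andP[].
- by have := pl _ _ iyl ixl lt_yx; rewrite !nth_index // eyx.
- by move/eqP: xy => []; rewrite -(nth_index x xl) eq_xy nth_index.
Qed.

End Existence.

(* R(n_1, ..., n_t), with the colours numbered from 0 to t - 1. *)
Definition dirRamsey (t : nat) (n : 'I_t -> nat) : nat :=
  ex_minn (ramsey_arrow_ex n).

Definition dirRamsey_diag (t n : nat) : nat := dirRamsey (fun _ : 'I_t => n).

(* Main.v *)
Require Import Defs.
From mathcomp Require Import all_boot.
From mathcomp Require Import ssralg zmodp.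

(** The bound [m < R_t(4)] follows from the existence of a tournament
    on [m] vertices, coloured with [t] colours, that has no monochromatic
    transitive subtournament of order 4.

    For [t = 2] and [m = 125], take the vertices in the field with 125 elements
    and let [S] be the group of nonzero fourth powers and [alpha] a generator of
    the multiplicative group.  As -1 is a square but not a fourth power, the four cosets of [S]
    are [S], [alpha S], [-S] and [- alpha S]; so giving [x -> y] the colour 0 when
    [y - x] is in [S] and the colour 1 when [y - x] is in [alpha S] defines a
    coloured tournament.  By translation a monochromatic transitive
    subtournament of order 4 may be taken to start at 0, which leaves a small
    finite search ([GF125_tt4_free]).

    The Paley tournament on 7 vertices, whose arcs [x -> y] are those with
    [y - x] a nonzero square modulo 7, has no transitive subtournament of
    order 4.  Replacing each of its vertices by a copy of a tournament coloured
    with [t] colours, and giving a new colour to the arcs between copies,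
    multiplies the order by 7 and creates no monochromatic transitive
    subtournament of order 4 ([subst_tt_free]).  Iterating [t - 2] times from the
    tournament on 125 vertices gives the bound. *)

Set Implicit Arguments.
Unset Strict Implicit.
Unset Printing Implicit Defensive.

Import GRing.Theory.

(** * Coloured tournaments *)

Section ColouredTournament.
Variables (V : eqType) (t : nat).

(** A tournament coloured with [t] colours is encoded by a single function [h]:
    [h x y = Some i] means that [x -> y] is an arc of colour [i], and
    [h x y = None] that [x -> y] is not an arc. *)
Definition coloured_tournament (h : V -> V -> option 'I_t) : Prop :=
  (forall x, h x x = None) /\
  (forall x y, x != y -> isSome (h x y) (+) isSome (h y x)).

(** No monochromatic transitive subtournament of order [k]. *)
Definition tt_free (k : nat) (h : V -> V -> option 'I_t) : Prop :=
  forall (i : 'I_t) (l : seq V), size l = k ->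
    ~~ pairwise (fun x y => h x y == Some i) l.

End ColouredTournament.

(** If the Ramsey number [m] were at most [#|V|], the restriction of [h] to [m]
    vertices would contradict its definition.  The colour [i0] is only a
    default for the pairs that are not arcs. *)
Lemma tt_free_lt_dirRamsey (V : finType) t (i0 : 'I_t) k
    (h : V -> V -> option 'I_t) :
  coloured_tournament h -> tt_free k h -> #|V| < dirRamsey_diag t k.
Proof.
move=> [h_irr h_tot] h_free; rewrite /dirRamsey_diag /dirRamsey.
case: ex_minnP => m arrow_m _; rewrite ltnNge; apply/negP => le_mV.
pose f (x : 'I_m) : V := enum_val (widen_ord le_mV x).
have f_inj : injective f.
  by move=> x y /enum_val_inj/(congr1 val) /= /val_inj.
pose e := [ffun p : 'I_m * 'I_m => isSome (h (f p.1) (f p.2))].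
pose c := [ffun p : 'I_m * 'I_m => odflt i0 (h (f p.1) (f p.2))].
have tour_e : tournament (fun x y => e (x, y)).
  apply/andP; split; first by apply/forallP=> x; rewrite ffunE /= h_irr.
  apply/forallP=> x; apply/forallP=> y; apply/implyP=> xy.
  by rewrite !ffunE /=; apply: h_tot; rewrite (inj_eq f_inj).
move/forallP/(_ e)/forallP/(_ c)/implyP/(_ tour_e): arrow_m.
case/existsP=> i /existsP[A /and3P[/eqP cardA trA monoA]].
case/existsP: trA => s /andP[/eqP sA pw_s].
have /negP := h_free i (map f s) ltac:(by rewrite size_map size_tuple).
apply; rewrite pairwise_map.
apply: (sub_in_pairwise (P := [in A])) pw_s; last first.
  by apply/allP=> x xs; rewrite /= -sA inE.
move=> x y xA yA /= exy.
move/forall_inP/(_ _ xA)/forall_inP/(_ _ yA)/implyP/(_ exy): monoA.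
by move: exy; rewrite !ffunE /=; case: (h _ _) => //= j _ /eqP->.
Qed.

Section Substitution.
Variables (W V : eqType) (s t : nat).
Variables (g : W -> W -> option 'I_s) (h : V -> V -> option 'I_t).

(** Each vertex of [g] is replaced by a copy of [h], the two sets of colours
    being made disjoint. *)
Definition subst (p q : W * V) : option 'I_(s + t) :=
  if p.1 == q.1 then omap (@rshift s t) (h p.2 q.2)
  else omap (@lshift s t) (g p.1 q.1).

Lemma subst_coloured_tournament :
  coloured_tournament g -> coloured_tournament h -> coloured_tournament subst.
Proof.
move=> [_ g_tot] [h_irr h_tot]; split=> [[w v] | [w v] [w' v']].
  by rewrite /subst /= eqxx h_irr.
rewrite /subst xpair_eqE negb_and /= [w' == w]eq_sym.
have [_ /= vv' | ww' _] := eqVneq w w'.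
  by move: (h_tot _ _ vv'); case: (h v v'); case: (h v' v).
by move: (g_tot _ _ ww'); case: (g w w'); case: (g w' w).
Qed.

(** A monochromatic transitive subtournament in a colour of [g]
    meets each copy at most once, so it projects to one of [g]; in a colour of
    [h] it lies in a single copy, so it projects to one of [h]. *)
Lemma subst_tt_free k : tt_free k g -> tt_free k h -> tt_free k subst.
Proof.
move=> g_free h_free i l sz_l; apply/negP.
rewrite -(splitK i); case: (split i) => j /= pw_l.
- have /negP := g_free j (map fst l) ltac:(by rewrite size_map).
  apply; rewrite pairwise_map; apply: sub_pairwise pw_l => p q /=.
  rewrite /subst; case: (p.1 == q.1).
    by case: (h _ _) => //= a /eqP/Some_inj/eqP; rewrite eq_rlshift.
  by case: (g _ _) => //= a /eqP/Some_inj/eqP; rewrite eq_lshift => /eqP->.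
- have /negP := h_free j (map snd l) ltac:(by rewrite size_map).
  apply; rewrite pairwise_map; apply: sub_pairwise pw_l => p q /=.
  rewrite /subst; case: (p.1 == q.1).
    by case: (h _ _) => //= a /eqP/Some_inj/eqP; rewrite eq_rshift => /eqP->.
  by case: (g _ _) => //= a /eqP/Some_inj/eqP; rewrite eq_lrshift.
Qed.

End Substitution.

(** * Translation-invariant tournaments *)

Section Cayley.
Local Open Scope ring_scope.
Variables (V : zmodType) (t : nat) (chi : V -> option 'I_t).

(** The arc [x -> y] is coloured according to the difference [y - x]. *)
Definition cayley (x y : V) : option 'I_t := chi (y - x).

(** In these two tests [elts] stands for a list of all the elements of [V], given
    explicitly so that the tests evaluate; the enumerations of the [finType]
    instances of ordinals do not.  The first test says that each nonzero [z] has
    a colour or its opposite does, but not both. *)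
Definition cayley_tournament_test (elts : seq V) : bool :=
  ~~ isSome (chi 0) &&
  all (fun z => (z != 0) ==> (isSome (chi z) (+) isSome (chi (- z)))) elts.

(** For each arc [0 -> a], of colour [i] say, there is no arc of colour [i]
    within the common [i]-out-neighbourhood of [0] and [a]. *)
Definition cayley_tt4_test (elts : seq V) : bool :=
  all (fun a =>
    if chi a is Some i then
      let N := [seq b <- elts | (chi b == Some i) && (chi (b - a) == Some i)] in
      all (fun b => all (fun c => chi (c - b) != Some i) N) N
    else true) elts.

Variables (elts : seq V) (eltsP : forall z, z \in elts).

Lemma cayley_coloured_tournament :
  cayley_tournament_test elts -> coloured_tournament cayley.
Proof.
case/andP=> chi0 /allP chiN; split=> [x | x y xy]; rewrite /cayley.
  by rewrite subrr; case: (chi 0) chi0.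
have := chiN _ (eltsP (y - x)).
by rewrite subr_eq0 eq_sym xy opprB.
Qed.

Lemma cayley_tt4_free : cayley_tt4_test elts -> tt_free 4 cayley.
Proof.
move=> /allP test i [|x [|a [|b [|c []]]]] // _; apply/negP.
rewrite /= !andbT /cayley => /andP[/and3P[xa xb xc] /andP[/andP[ab ac] bc]].
have subK y z : (z - x) - (y - x) = z - y by rewrite opprB addrA subrK.
have := test _ (eltsP (a - x)); rewrite (eqP xa) => /allP/(_ (b - x)).
rewrite mem_filter xb subK ab eltsP => /(_ isT)/allP/(_ (c - x)).
by rewrite mem_filter xc !subK ac bc eltsP => /(_ isT).
Qed.

End Cayley.

(** The elements of the integers modulo [p.+1], as a list that evaluates. *)
Definition Zp_elts (p : nat) : seq 'I_p.+1 := map inZp (iota 0 p.+1).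

Lemma mem_Zp_elts p (z : 'I_p.+1) : z \in Zp_elts p.
Proof. by apply/mapP; exists (val z); rewrite ?mem_iota ?valZpK /=. Qed.

(** * The Paley tournament on 7 vertices *)

(** The nonzero squares modulo 7 are 1, 2 and 4. *)
Definition Paley7_chi (z : 'I_7) : option 'I_1 :=
  if val z \in [:: 1; 2; 4] then Some ord0 else None.

Definition Paley7 := cayley Paley7_chi.

Lemma Paley7_coloured_tournament : coloured_tournament Paley7.
Proof.
by apply: (cayley_coloured_tournament (@mem_Zp_elts 6)); vm_compute.
Qed.

Lemma Paley7_tt4_free : tt_free 4 Paley7.
Proof. by apply: (cayley_tt4_free (@mem_Zp_elts 6)); vm_compute. Qed.

(** * The quartic residue tournament on 125 vertices *)

(** The additive group of the field with 125 elements: [(a, b, c)] stands for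
    [a + b alpha + c alpha^2], where [alpha^3 = alpha + 2]. *)
Definition GF125 : zmodType := ('I_5 * 'I_5 * 'I_5)%type.

(** Multiplication by [alpha], which has order 124. *)
Definition mul_alpha (z : GF125) : GF125 :=
  let: (a, b, c) := z in (c + c, a + c, b)%R.

(** The 31 nonzero fourth powers: 1, [alpha^4], [alpha^8] and so on. *)
Definition quartic_residues : seq GF125 :=
  traject (iter 4 mul_alpha) (inZp 1, inZp 0, inZp 0) 31.

Definition alpha_quartic_residues : seq GF125 := map mul_alpha quartic_residues.

Definition GF125_chi (z : GF125) : option 'I_2 :=
  if z \in quartic_residues then Some ord0
  else if z \in alpha_quartic_residues then Some ord_max
  else None.

Definition GF125_tournament := cayley GF125_chi.

Definition GF125_elts : seq GF125 :=
  let Z5 := Zp_elts 4 in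
  [seq (ab, c) | ab <- [seq (a, b) | a <- Z5, b <- Z5], c <- Z5].

Lemma mem_GF125_elts (z : GF125) : z \in GF125_elts.
Proof.
case: z => [[a b] c]; apply/allpairsP; exists ((a, b), c).
split=> //; last exact: mem_Zp_elts.
by apply/allpairsP; exists (a, b); rewrite !mem_Zp_elts.
Qed.

Lemma GF125_coloured_tournament : coloured_tournament GF125_tournament.
Proof. by apply: (cayley_coloured_tournament mem_GF125_elts); vm_compute. Qed.

Lemma GF125_tt4_free : tt_free 4 GF125_tournament.
Proof. by apply: (cayley_tt4_free mem_GF125_elts); vm_compute. Qed.

(** * The lower bound *)

Lemma tt4_free_coloured_tournament_ex (n : nat) :
  exists (V : finType) (h : V -> V -> option 'I_n.+2),
    [/\ #|V| = 125 * 7 ^ n, coloured_tournament h & tt_free 4 h].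
Proof.
elim: n => [|n [V [h [cardV h_tour h_free]]]].
  exists ('I_5 * 'I_5 * 'I_5)%type, GF125_tournament; split.
  - by rewrite !card_prod !card_ord.
  - exact: GF125_coloured_tournament.
  - exact: GF125_tt4_free.
exists ('I_7 * V)%type, (subst Paley7 h); split.
- by rewrite card_prod card_ord cardV expnS mulnCA.
- exact: subst_coloured_tournament Paley7_coloured_tournament h_tour.
- exact: subst_tt_free Paley7_tt4_free h_free.
Qed.

Theorem corollary2p5 (t : nat) (ht : 2 <= t) :
  125 * 7 ^ (t - 2) + 1 <= dirRamsey_diag t 4.
Proof.
case: t ht => [|[|n]] // _; rewrite subn2 addn1 /=.
have [V [h [<- h_tour h_free]]] := tt4_free_coloured_tournament_ex n.
exact: (tt_free_lt_dirRamsey ord0 h_tour h_free).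
Qed.
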